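(* Let $(X,T)$ be an equicontinuous flow, where $X$ is a compact metric space, and let $(2^X,T)$ be the induced flow. Then $E(X)$ is conjugate to $E(2^X)$; that is, there is a homeomorphism $h:E(2^X)\to E(X)$ with $h(tp)=t\,h(p)$ for all $t\in T$ and $p\in E(2^X)$.
   Context: A flow $(X,T)$ is a continuous action of a discrete group $T$ on a compact space $X$; $\pi^t:X\to X$ denotes the map $x\mapsto tx$. For a compact metric space $(X,d)$, the flow $(X,T)$ is equicontinuous if for every $y\in X$ and $\epsilon>0$ there is a neighbourhood $U$ of $y$ such that $d(tx,ty)<\epsilon$ for all $x\in U$, $t\in T$. $2^X$ is the space of all nonempty closed subsets of $X$ with the Vietoris topology (equivalently, the Hausdorff metric topology), and $(X,T)$ induces the flow $(2^X,T)$ via $\pi^t_*(A)=\pi^t(A)$. For a flow $(Y,T)$, the enveloping semigroup $E(Y)$ is the closure of $\{\pi^t: t\in T\}$ in $Y^Y$ with the product topology; $T$ acts on $E(Y)$ by $(t,p)\mapsto tp:=\pi^t\circ p$. Two flows are conjugate if there is a $T$-equivariant homeomorphism between them. *)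

(* Defs.v *)
From HB Require Import structures.
From mathcomp Require Import all_boot all_order all_algebra finmap.
From mathcomp Require Import all_classical all_reals.
From mathcomp Require Import topology.

Set Implicit Arguments.
Unset Strict Implicit.
Unset Printing Implicit Defensive.

Import Order.TTheory GRing.Theory Num.Theory.

Local Open Scope classical_set_scope.
Local Open Scope ring_scope.

(* As [T] is discrete, joint continuity of the action [T * X -> X] amounts to
   the continuity of each of the maps [x |-> t x]. *)
Record flow (T : groupType) (X : topologicalType) := Flow {
  flow_act :> T -> X -> X ;
  flow_compact : compact [set: X] ;
  flow_continuous : forall t, continuous (flow_act t) ;
  flow_act1 : forall x, flow_act 1%g x = x ;
  flow_actM : forall s t x, flow_act (s * t)%g x = flow_act s (flow_act t x)
}.

Definition equicontinuous_flow (R : realType) (X : metricType R)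
    (T : groupType) (F : flow T X) : Prop :=
  forall (y : X) (e : R), 0 < e ->
    \forall x \near y, forall t : T, mdist (F t x) (F t y) < e.

Definition conjugate_flows (T : groupType) (X Y : topologicalType)
    (F : flow T X) (G : flow T Y) : Prop :=
  exists (h : X -> Y) (k : Y -> X),
    [/\ continuous h, continuous k, cancel h k & cancel k h] /\
    forall t x, h (F t x) = G t (h x).

Lemma flow_actK (T : groupType) (X : topologicalType) (F : flow T X) t :
  cancel (F t) (F t^-1%g).
Proof. by move=> x; rewrite -flow_actM mulVg flow_act1. Qed.

Lemma flow_actVK (T : groupType) (X : topologicalType) (F : flow T X) t :
  cancel (F t^-1%g) (F t).
Proof. by move=> x; rewrite -flow_actM mulgV flow_act1. Qed.

Lemma flow_imageE (T : groupType) (X : topologicalType) (F : flow T X) t A :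
  F t @` A = F t^-1%g @^-1` A.
Proof.
apply/seteqP; split=> [_ [x Ax <-]|x Ax] /=; first by rewrite flow_actK.
by exists (F t^-1%g x) => //; rewrite flow_actVK.
Qed.

Record hyperspace (X : topologicalType) := Hyperspace {
  hyperspace_set :> set X ;
  hyperspace_closed : closed hyperspace_set ;
  hyperspace_neq0 : hyperspace_set !=set0
}.

Lemma hyperspace_inj (X : topologicalType) : injective (@hyperspace_set X).
Proof.
move=> [A cA A0] [B cB B0] /= AB; rewrite AB in cA A0 *.
by congr Hyperspace; exact: Prop_irrelevance.
Qed.

HB.instance Definition _ (X : topologicalType) := gen_eqMixin (hyperspace X).
HB.instance Definition _ (X : topologicalType) :=
  gen_choiceMixin (hyperspace X).

Definition vietoris_subbase (X : topologicalType) :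
    set (set (hyperspace X)) :=
  [set [set A : hyperspace X | A `<=` U] | U in open] `|`
  [set [set A : hyperspace X | A `&` U !=set0] | U in open].

HB.instance Definition _ (X : topologicalType) :=
  isSubBaseTopological.Build (hyperspace X) (@vietoris_subbase X) id.

Lemma vietoris_open (X : topologicalType) (B : set (hyperspace X)) :
  vietoris_subbase B -> open B.
Proof.
move=> sB; rewrite /open /=.
exists [set B]; last by rewrite bigcup_set1.
move=> _ ->; exists [fset B]%fset.
  by move=> C /fset1P ->; exact/mem_set.
by rewrite set_fset1 bigcap_set1.
Qed.

Lemma cvg_vietoris (X : topologicalType) (F : set_system (hyperspace X))
    (A : hyperspace X) : Filter F ->
  (forall B, vietoris_subbase B -> B A -> F B) -> F --> A.
Proof.
move=> FF FB N /=; rewrite nbhsE => -[O [oO OA] /filterS]; apply.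
move: oO; rewrite /open /= => -[D' sD' DO]; rewrite -DO in OA *.
case: OA => C D'C CA; apply: (@filterS _ F _ C); first by move=> x Cx; exists C.
have [K sK KC] := sD' _ D'C; rewrite -KC in CA *.
apply: filter_bigI => B KB; apply: FB; last exact: CA.
exact/set_mem/sK.
Qed.

Section induced_flow.
Context (T : groupType) (X : topologicalType) (F : flow T X).

Lemma hyper_act_closed t (A : hyperspace X) : closed (F t @` A).
Proof.
rewrite flow_imageE; apply: preimage_closed; last exact: hyperspace_closed.
by move=> x _; exact: flow_continuous.
Qed.

Lemma hyper_act_neq0 t (A : hyperspace X) : F t @` A !=set0.
Proof. by have [x Ax] := hyperspace_neq0 A; exists (F t x); exists x. Qed.

Definition hyper_act t (A : hyperspace X) : hyperspace X :=
  Hyperspace (@hyper_act_closed t A) (@hyper_act_neq0 t A).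

Lemma hyper_act_continuous t : continuous (hyper_act t).
Proof.
move=> A.
have FA : Filter (hyper_act t @ A) by apply: fmap_filter; exact: nbhs_filter.
apply: (@cvg_vietoris _ (hyper_act t @ A) _ FA) => B [|] [U oU <-] /= AU.
- have oV : open (F t @^-1` U).
    by apply: open_comp oU => x _; exact: flow_continuous.
  apply: (@filterS _ _ _ [set C : hyperspace X | C `<=` F t @^-1` U]).
    by move=> C /= CU _ [x /CU Ux <-].
  apply: open_nbhs_nbhs; split; last by move=> x Ax; apply: AU; exists x.
  by apply: vietoris_open; left; exists (F t @^-1` U).
- have oV : open (F t @^-1` U).
    by apply: open_comp oU => x _; exact: flow_continuous.
  apply: (@filterS _ _ _ [set C : hyperspace X | C `&` F t @^-1` U !=set0]).
    by move=> C /= [x [Cx Ux]]; exists (F t x); split=> //; exists x.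
  apply: open_nbhs_nbhs; split.
    by apply: vietoris_open; right; exists (F t @^-1` U).
  by case: AU => _ [[x Ax <-] Ux]; exists x.
Qed.

Lemma hyper_act1 A : hyper_act 1%g A = A.
Proof.
apply: hyperspace_inj; rewrite /= -[RHS]image_id.
by apply: eq_imagel => x _; exact: flow_act1.
Qed.

Lemma hyper_actM s t A : hyper_act (s * t)%g A = hyper_act s (hyper_act t A).
Proof.
apply: hyperspace_inj; rewrite /= image_comp.
by apply: eq_imagel => x _; exact: flow_actM.
Qed.

Lemma hyperspace_compact : compact [set: hyperspace X].
Proof.
rewrite compact_ultra => G GU _.
have XC := flow_compact F; rewrite compact_near_coveringP in XC.
have PG : ProperFilter G by exact: ultra_proper.
pose L := [set x | forall U, open U -> U x ->
  G [set A : hyperspace X | A `&` U !=set0]].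
have missE U : ~ G [set A : hyperspace X | A `&` U !=set0] ->
    G [set A : hyperspace X | A `<=` ~` U].
  move=> nG.
  have [//|] := in_ultra_setVsetC [set A : hyperspace X | A `&` U !=set0] GU.
  by apply: filterS => A /= nAU x Ax Ux; apply: nAU; exists x.
have notL x : ~ L x -> \forall y \near x & A \near G, ~ hyperspace_set A y.
  move=> /existsNP [U] /not_implyP [oU] /not_implyP [Ux /missE GU'].
  exists (U, [set A : hyperspace X | A `<=` ~` U]).
    by split=> //=; exact: open_nbhs_nbhs.
  by case=> y A /= [Uy AU] /AU.
have nearL K : closed K -> L `<=` ~` K ->
    \forall A \near G, hyperspace_set A `<=` ~` K.
  move=> cK LK.
  have : \forall A \near G, [set: X] `<=` [set y | ~ (hyperspace_set A `&` K) y].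
    apply: (XC _ G (fun A y => ~ (hyperspace_set A `&` K) y)) => x _.
    have [Kx|nKx] := pselect (K x).
      have nLx : ~ L x by move=> /LK.
      have [[U V] /= [xU GV] UV] := notL _ nLx.
      exists (U, V) => // -[y A] /= [Uy VA] [Ay _].
      exact: (UV (y, A)).
    exists (~` K, setT) => /=; last by case=> y A /= [nKy _] [].
    split; last exact: filterT.
    by apply: open_nbhs_nbhs; split=> //; exact: closed_openC.
  by apply: filterS => A /= + y Ay Ky => /(_ y I); apply.
have cL : closed L.
  move=> x clLx U oU Ux.
  have [y [Ly Uy]] := clLx U (open_nbhs_nbhs (conj oU Ux)).
  exact: Ly oU Uy.
have L0 : L !=set0.
  apply/set0P/eqP => L0.
  have LT : L `<=` ~` setT by rewrite L0.
  have /filter_ex [A AT] := nearL setT closedT LT.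
  by have [x /AT] := hyperspace_neq0 A; apply.
exists (Hyperspace cL L0); split=> //; apply: cvg_vietoris.
move=> B [|] [U oU <-] /=.
  move=> LU; have := nearL (~` U) (open_closedC oU).
  by rewrite setCK; apply.
by move=> [x [Lx Ux]]; exact: Lx oU Ux.
Qed.

Definition hyper_flow : flow T (hyperspace X) :=
  Flow hyperspace_compact hyper_act_continuous hyper_act1 hyper_actM.

End induced_flow.

Section enveloping.
Context (T : groupType) (Y : topologicalType) (F : flow T Y).

Definition enveloping : set {ptws Y -> Y} :=
  closure (range (fun t : T => (F t : {ptws Y -> Y}))).

Lemma ptws_cvgP (G : set_system {ptws Y -> Y}) (p : {ptws Y -> Y}) :
  Filter G -> (forall y, (fun q : {ptws Y -> Y} => q y) @ G --> p y) -> G --> p.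
Proof.
move=> FG Gp; apply/cvg_sup => y A [_ [[B oB <-] Bp BA]]; apply: (filterS BA).
by apply: Gp; exact: open_nbhs_nbhs.
Qed.

Lemma ptws_eval_continuous y : continuous (fun q : {ptws Y -> Y} => q y).
Proof. exact: (@proj_continuous Y (fun=> Y) y). Qed.

Lemma postcomp_continuous t :
  continuous ((fun p => F t \o p) : {ptws Y -> Y} -> {ptws Y -> Y}).
Proof.
move=> p.
have FP : Filter (((fun q => F t \o q) : {ptws Y -> Y} -> {ptws Y -> Y}) @ p).
  by apply: fmap_filter; exact: nbhs_filter.
apply: (ptws_cvgP FP) => y.
apply: (@continuous_comp {ptws Y -> Y} Y Y (fun q => q y) (F t)).
  exact: ptws_eval_continuous.
exact: flow_continuous.
Qed.

Lemma enveloping_act_subproof t (p : enveloping) :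
  (F t \o set_val p : {ptws Y -> Y}) \in enveloping.
Proof.
apply/mem_set => B /postcomp_continuous.
move=> /(set_mem (valP p)) [_ [[s _ <-] Bs]].
exists (F (t * s)%g); split; first by exists (t * s)%g.
rewrite (_ : F (t * s)%g = F t \o F s) //.
by apply/funext => y; exact: flow_actM.
Qed.

Definition enveloping_act t (p : enveloping) : enveloping :=
  exist _ (F t \o set_val p : {ptws Y -> Y}) (enveloping_act_subproof t p).

Lemma enveloping_act_continuous t : continuous (enveloping_act t).
Proof.
apply: continuous_comp_initial => p.
apply: (@continuous_comp _ {ptws Y -> Y} {ptws Y -> Y} set_val
  (fun p => F t \o p)).
  exact: initial_continuous.
exact: postcomp_continuous.
Qed.

Lemma enveloping_act1 p : enveloping_act 1%g p = p.
Proof.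
apply: val_inj => /=; apply/funext => y /=; exact: flow_act1.
Qed.

Lemma enveloping_actM s t p :
  enveloping_act (s * t)%g p = enveloping_act s (enveloping_act t p).
Proof.
apply: val_inj => /=; apply/funext => y /=; exact: flow_actM.
Qed.

Lemma enveloping_compact : compact [set: enveloping].
Proof.
have EC : compact enveloping.
  apply: (@subclosed_compact _ _ [set f : {ptws Y -> Y} | forall y, setT (f y)]).
  - exact: closed_closure.
  - apply: (@tychonoff Y (fun=> Y) (fun=> setT)) => y; exact: flow_compact F.
  - by move=> f _ y.
move=> G GG _.
have GE : (set_val @ G : set_system {ptws Y -> Y}) enveloping.
  apply: (@filterS _ G _ setT) => [[q Eq] _|]; last exact: filterT.
  exact: set_mem Eq.
have [p [Ep Gp]] := EC _ (fmap_proper_filter _ GG) GE.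
exists (exist _ p (mem_set Ep)); split=> // A B GA [_ [[O oO <-] Op OB]].
have GO : (set_val @ G) (set_val @` A) by apply: (@filterS _ G _ A) => // q Aq; exists q.
have [_ [[q Aq <-] Oq]] := Gp _ _ GO (open_nbhs_nbhs (conj oO Op)).
by exists q; split=> //; exact: OB.
Qed.

Definition enveloping_flow : flow T enveloping :=
  Flow enveloping_compact enveloping_act_continuous
    enveloping_act1 enveloping_actM.

End enveloping.

(* Main.v *)
Require Import Defs.
From mathcomp Require Import all_boot all_order all_algebra.
From mathcomp Require Import all_classical all_reals.
From mathcomp Require Import topology.
From mathcomp Require Import ring.

(** An element of [E(X)] is a pointwise limit of the maps [F t].  These are
    equicontinuous, so pointwise closeness of [q] to [p] at [y] already
    controls [q x] for all [x] near [y]: the evaluation [E(X) * X -> X] is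
    jointly continuous ([enveloping_eval_continuous]).  In particular each [p]
    in [E(X)] is continuous, so it sends nonempty closed sets to nonempty
    closed sets, and [p |-> (A |-> p(A))] is a map [k] from [E(X)] to
    [2^X -> 2^X] ([enveloping_image]).

    Joint continuity and the compactness of the closed sets [A] make [k]
    continuous for pointwise convergence ([hyper_image_continuous]), and [k]
    sends the translation [F t] of [X] to the translation by [t] of [2^X].
    Hence [k] maps [E(X)], the closure of the translations of [X], into the
    closure [E(2^X)] of those of [2^X].  Since [2^X] is Hausdorff
    ([hyperspace_hausdorff]), the image of the compact space [E(X)] is closed;
    it contains every translation of [2^X], hence all of [E(2^X)]
    ([range_enveloping_image]).  The value of [k p] at [{x}] is [{p x}], so [k]
    is injective.  A continuous bijection
    from a compact space to a Hausdorff one is a homeomorphism, and [k] is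
    equivariant because [(t p)(A) = t (p(A))]; the required conjugacy is the
    inverse of [k]. *)

Set Implicit Arguments.
Unset Strict Implicit.
Unset Printing Implicit Defensive.

Import Order.TTheory GRing.Theory Num.Theory.

Local Open Scope classical_set_scope.
Local Open Scope ring_scope.

Lemma compact_hausdorff_inv_continuous (X Y : topologicalType)
    (f : X -> Y) (g : Y -> X) :
  compact [set: X] -> hausdorff_space Y -> continuous f ->
  cancel f g -> cancel g f -> continuous g.
Proof.
move=> cX hY cf fK gK; apply/continuous_closedP => A clA.
have -> : g @^-1` A = f @` A.
  apply/seteqP; split=> [y Ay|_ [x Ax <-]] /=; last by rewrite fK.
  by exists (g y); rewrite ?gK.
apply: compact_closed => //; apply: continuous_compact.
  exact: continuous_subspaceT.
exact: subclosed_compact clA cX _.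
Qed.

Lemma inj_hausdorff (X Y : topologicalType) (f : X -> Y) :
  continuous f -> injective f -> hausdorff_space Y -> hausdorff_space X.
Proof.
move=> cf fI hY p q pq; apply/fI/hY => A B /cf pA /cf qB.
by have [x [Ax Bx]] := pq _ _ pA qB; exists (f x).
Qed.

(** If [x] is in [A] but not in the closed set [B], regularity gives a
    neighbourhood [V] of [x] whose closure misses [B]; then meeting the interior
    of [V] and avoiding the closure of [V] are incompatible Vietoris-open
    conditions, satisfied by [A] and [B] respectively. *)
Lemma hyperspace_hausdorff (X : topologicalType) :
  hausdorff_space X -> compact [set: X] -> hausdorff_space (hyperspace X).
Proof.
move=> hX cX.
have sub (A B : hyperspace X) : cluster (nbhs A) B -> A `<=` B.
  move=> AB x Ax; apply: contrapT => nBx.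
  have [|V] := @compact_regular X x setT hX cX filterT (~` B).
    apply: open_nbhs_nbhs; split; last exact: nBx.
    exact/closed_openC/hyperspace_closed.
  move=> xV clVB.
  have oA : open [set C : hyperspace X | C `&` V° !=set0].
    by apply: vietoris_open; right; exists V° => //; exact: open_interior.
  have oB : open [set C : hyperspace X | C `<=` ~` closure V].
    apply: vietoris_open; left; exists (~` closure V) => //.
    exact/closed_openC/closed_closure.
  have [] := AB _ _ (open_nbhs_nbhs (conj oA _)) (open_nbhs_nbhs (conj oB _)).
  - by exists x; split => //; exact: nbhs_singleton (nbhs_interior xV).
  - by move=> y By /clVB.
  - move=> C [[y [Cy /interior_subset Vy]] /(_ _ Cy)]; apply.
    exact: subset_closure.
move=> A B AB; apply: hyperspace_inj; apply/seteqP; split; first exact: sub.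
by apply: sub => U V BU AV; rewrite setIC; exact: AB.
Qed.

(** The tube lemma: by joint continuity the condition [U (f (q, x))] persists
    near each [(p, x)], and compactness of [K] makes the neighbourhood of [p]
    uniform in [x]. *)
Lemma compact_image_subset_near (P X Y : topologicalType) (f : P * X -> Y)
    (p : P) (K : set X) (U : set Y) :
  continuous f -> compact K -> open U -> (forall x, K x -> U (f (p, x))) ->
  \forall q \near p, forall x, K x -> U (f (q, x)).
Proof.
move=> cf /compact_near_coveringP cK oU KU.
apply: (cK _ (nbhs p) (fun q x => U (f (q, x)))) => x Kx.
have [[V W] /= [pV xW] VW] :
    nbhs (p, x) (f @^-1` U).
  by apply: cf; exact: open_nbhs_nbhs (conj oU (KU _ Kx)).
by exists (W, V) => //= -[y q] /= [Wy Vq]; exact: (VW (q, y)).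
Qed.

Section hyper_image.
Context (P X : topologicalType) (f : P * X -> X).
Hypotheses (hX : hausdorff_space X) (cX : compact [set: X]) (cf : continuous f).

Let section_continuous p : continuous (fun x => f (p, x)).
Proof.
move=> x; apply: (@continuous_comp _ _ _ (pair p) f); last exact: cf.
by apply: cvg_pair; [exact: cvg_cst|exact: cvg_id].
Qed.

Lemma hyper_image_closed p (A : hyperspace X) :
  closed ((fun x => f (p, x)) @` A).
Proof.
apply: compact_closed => //; apply: continuous_compact.
  exact: continuous_subspaceT.
exact: subclosed_compact (@hyperspace_closed _ A) cX _.
Qed.

Lemma hyper_image_neq0 p (A : hyperspace X) : (fun x => f (p, x)) @` A !=set0.
Proof. by have [x Ax] := hyperspace_neq0 A; exists (f (p, x)); exists x. Qed.

Definition hyper_image p : {ptws hyperspace X -> hyperspace X} :=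
  fun A => Hyperspace (@hyper_image_closed p A) (@hyper_image_neq0 p A).

(** Joint continuity of [f] is essential: continuity in each variable
    separately would not preserve the upper Vietoris condition
    [f (p, -) @` A `<=` U] for [p] nearby. *)
Lemma hyper_image_continuous : continuous hyper_image.
Proof.
move=> p; apply: ptws_cvgP => A; apply: cvg_vietoris => _ [|] [U oU <-] /= AU.
- have cA : compact A.
    exact: subclosed_compact (@hyperspace_closed _ A) cX _.
  have AU' x : hyperspace_set A x -> U (f (p, x)).
    by move=> Ax; apply: AU; exists x.
  have := compact_image_subset_near cf cA oU AU'.
  by apply: filterS => q qA _ [x Ax <-]; exact: qA.
- case: AU => _ [[x Ax <-] Ux].
  have xU y : [set x] y -> U (f (p, y)) by move=> ->.
  have := compact_image_subset_near cf (@compact_set1 X x) oU xU.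
  apply: filterS => q qx.
  by exists (f (q, x)); split; [exists x|exact: qx].
Qed.

End hyper_image.

Section equicontinuous.
Context (R : realType) (X : metricType R) (T : groupType) (F : flow T X).
Hypothesis hF : equicontinuous_flow F.

(** Equicontinuity passes to pointwise limits: [p] is [e / 3]-close to one
    translation at both [x] and [y]. *)
Lemma enveloping_equicontinuous (y : X) (e : R) : 0 < e ->
  \forall x \near y, forall p : enveloping F,
    mdist (set_val p x) (set_val p y) < e.
Proof.
move=> e0; have e3 : 0 < e / 3%:R by rewrite divr_gt0.
have := hF y e3; apply: filterS => x xy [p Ep] /=.
have nb z : nbhs (p : {ptws X -> X})
    [set q : {ptws X -> X} | mdist (p z) (q z) < e / 3%:R].
  have := nbhsx_ballx (p z) _ e3; rewrite ballEmdist.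
  exact: (@ptws_eval_continuous X z p).
have [_ [[t _ <-] [/= px py]]] := set_mem Ep _ (filterI (nb x) (nb y)).
have -> : e = e / 3%:R + (e / 3%:R + e / 3%:R) by field.
apply: le_lt_trans (metric_triangle _ (F t x) _) _; rewrite ltrD//.
apply: le_lt_trans (metric_triangle _ (F t y) _) _; rewrite ltrD//.
by rewrite metric_sym.
Qed.

Definition enveloping_eval (z : enveloping F * X) : X := set_val z.1 z.2.

(** The distance from [p y] to [q x] is at most that from [p y] to [q y], small
    for [q] near [p], plus that from [q y] to [q x], small for [x] near [y]
    uniformly in [q]. *)
Lemma enveloping_eval_continuous : continuous enveloping_eval.
Proof.
move=> [p y]; apply/cvg_ballP => e e0.
have e2 : 0 < e / 2%:R by rewrite divr_gt0.
have py : \forall q \near p, mdist (set_val p y) (set_val q y) < e / 2%:R.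
  have := nbhsx_ballx (set_val p y) _ e2; rewrite ballEmdist.
  apply: (@continuous_comp _ {ptws X -> X} X set_val (fun q => q y) p).
    exact: initial_continuous.
  exact: ptws_eval_continuous.
exists ([set q | mdist (set_val p y) (set_val q y) < e / 2%:R],
  [set x | forall p : enveloping F,
    mdist (set_val p x) (set_val p y) < e / 2%:R]).
  by split => //=; exact: enveloping_equicontinuous.
move=> [q x] /= [qy /(_ q) xq]; rewrite ballEmdist /= (splitr e).
apply: le_lt_trans (metric_triangle _ (set_val q y) _) _; rewrite ltrD//.
by rewrite metric_sym.
Qed.

Definition enveloping_image :
    enveloping F -> {ptws hyperspace X -> hyperspace X} :=
  hyper_image (@metric_hausdorff _ X) (flow_compact F)
    enveloping_eval_continuous.

Lemma enveloping_image_continuous : continuous enveloping_image.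
Proof. exact: hyper_image_continuous. Qed.

Lemma enveloping_image_inj : injective enveloping_image.
Proof.
move=> p q kpq; apply: val_inj; apply/funext => x.
have clx : closed [set x].
  by apply: (compact_closed (@metric_hausdorff _ X)); exact: compact_set1.
have x0 : [set x] !=set0 by exists x.
have := congr1 (fun r => hyperspace_set (r (Hyperspace clx x0))) kpq.
by rewrite /= !image_set1 => /seteqP[/(_ _ erefl)].
Qed.

Lemma translation_enveloping t : (F t : {ptws X -> X}) \in enveloping F.
Proof. by apply/mem_set/subset_closure; exists t. Qed.

Definition translation t : enveloping F :=
  exist _ (F t : {ptws X -> X}) (translation_enveloping t).

Lemma enveloping_image_translation t :
  enveloping_image (translation t) = hyper_flow F t.
Proof. by apply/funext => A; exact: hyperspace_inj. Qed.

(** One inclusion is continuity of [enveloping_image] together with density of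
    the translations; the other holds because the range, being compact in a
    Hausdorff space, is closed. *)
Lemma range_enveloping_image :
  range enveloping_image = enveloping (hyper_flow F).
Proof.
apply/seteqP; split=> [_ [p _ <-] B|].
  move=> /enveloping_image_continuous [_ [[O oO <-] Op OB]].
  have [_ [[t _ <-] Ot]] := set_mem (valP p) _ (open_nbhs_nbhs (conj oO Op)).
  exists (hyper_flow F t); split; first by exists t.
  by have := OB (translation t) Ot; rewrite /= enveloping_image_translation.
have clk : closed (range enveloping_image).
  apply: compact_closed.
    apply: hausdorff_product => _; apply: hyperspace_hausdorff.
      exact: metric_hausdorff.
    exact: flow_compact F.
  apply: continuous_compact; last exact: enveloping_compact.
  exact/continuous_subspaceT/enveloping_image_continuous.
move=> r Er; apply: clk => B /Er [_ [[t _ <-] Bt]].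
exists (hyper_flow F t); split => //.
by exists (translation t) => //; exact: enveloping_image_translation.
Qed.

End equicontinuous.

Theorem theorem10p3 (R : realType) (X : metricType R) (T : groupType)
    (F : flow T X) (hF : equicontinuous_flow F) :
  conjugate_flows (enveloping_flow (hyper_flow F)) (enveloping_flow F).
Proof.
have kP p : enveloping_image hF p \in enveloping (hyper_flow F).
  by rewrite -(range_enveloping_image hF); apply/mem_set; exists p.
pose k p : enveloping (hyper_flow F) := exist _ (enveloping_image hF p) (kP p).
have kc : continuous k.
  exact/continuous_comp_initial/enveloping_image_continuous.
have kI : injective k.
  by move=> p q /(congr1 set_val); exact: enveloping_image_inj.
have kS (r : enveloping (hyper_flow F)) : exists p, k p = r.
  have : range (enveloping_image hF) (set_val r).
    by rewrite range_enveloping_image; exact: set_mem (valP r).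
  by move=> [p _ kp]; exists p; apply: val_inj.
have [h hK] := choice kS.
have kK : cancel k h by move=> p; apply: kI; rewrite hK.
exists h, k; split.
  split => //; apply: (compact_hausdorff_inv_continuous _ _ kc) => //.
    exact: enveloping_compact.
  apply: (inj_hausdorff (f := set_val)); first exact: initial_continuous.
    exact: val_inj.
  apply: hausdorff_product => _; apply: hyperspace_hausdorff.
    exact: metric_hausdorff.
  exact: flow_compact F.
(* Equivariance of [h] is that of [k], which is [(t p)(A) = t (p(A))]. *)
move=> t r; apply: kI; rewrite hK -{1}(hK r).
apply: val_inj; apply/funext => A; apply: hyperspace_inj.
by rewrite /= image_comp.
Qed.
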